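(* Let $V = \mathrm{Sym}^k \mathbf{C}^{k+1}$ as a representation of $G = \mathrm{SL}_{k+1}(\mathbf{C})$ with $k \geq 1$, or $V = \Lambda^m \mathbf{C}^{2m}$ as a representation of $G = \mathrm{SL}_{2m}(\mathbf{C})$ with $m \geq 1$. In both cases $V$ has a subspace $U$ with $\dim U = \dim V/2$ and $$\mathrm{diam}_+^{G}(V, U) = \frac{\ln \dim V}{2\ln 2}\bigl(1 + o(1)\bigr), \qquad \mathsf{C}(V) \geq \mathsf{R}(V, U) \geq \frac{\ln \dim V}{4 \ln 2},$$ where $o(1)$ refers to $k \to \infty$ in the first case and $m \to \infty$ in the second.
   Context: The groups act through their natural actions on $\mathbf{C}^{k+1}$ and $\mathbf{C}^{2m}$. For a group $H$ acting linearly on a finite-dimensional complex vector space $V$ and a nonzero subspace $U \leq V$, the group-additive diameter is $$\mathrm{diam}_+^{H}(V,U) = \min\{ m \mid g_1\cdot U + \dots + g_m\cdot U = V \text{ for some } g_1,\dots,g_m \in H\}.$$ If $H$ acts irreducibly on $V$, put $\mathsf{R}(V,U) = \mathrm{diam}_+^{H}(V,U) / \lceil \dim V/\dim U\rceil$, and the covering complexity of $V$ (with respect to $H$) is $\mathsf{C}(V) = \max_{0 \neq U \leq V} \mathsf{R}(V,U)$. *)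

(* Defs.v *)
From HB Require Import structures.
From mathcomp Require Import all_boot all_order all_algebra all_fingroup.
From mathcomp Require mpoly.
(* The notations of mpoly clash with those of mathcomp-analysis. *)
Import -(notations) mpoly.
From mathcomp Require Import all_classical all_reals all_analysis.
From mathcomp Require Import complex.

Set Implicit Arguments.
Unset Strict Implicit.
Unset Printing Implicit Defensive.

Import Order.TTheory GRing.Theory Num.Theory.

Local Open Scope ring_scope.

Section Representations.
Variables (F : fieldType) (gT : groupType).

Record representation (V : vectType F) := Representation {
  rep_fun :> gT -> 'End(V);
  rep1 : rep_fun 1%g = \1%VF;
  repM : forall x y, rep_fun (x * y)%g = (rep_fun x \o rep_fun y)%VF
}.

Variables (V : vectType F) (rho : representation V).
Implicit Type U : {vspace V}.

Definition covered_by_translates U (m : nat) : Prop :=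
  exists g : 'I_m -> gT, (\sum_(i < m) (rho (g i) @: U))%VS = fullv.

(* The value is 0 when no finite sum of translates of U is V; this does not
   happen when rho is irreducible and U is nonzero. *)
Definition diam_plus U : nat :=
  if pselect (exists m, `[< covered_by_translates U m >]) is left h
  then ex_minn h else 0%N.

Variable R : realType.

Definition covering_ratio U : R :=
  (diam_plus U)%:R /
  (Num.ceil ((\dim (fullv : {vspace V}))%:R / (\dim U)%:R : R))%:~R.

(* The maximum exists as soon as V is nonzero: if m translates of U add up to
   V and m is minimal, then no translate is contained in the sum of the
   others, so that m <= \dim V and covering_ratio has finitely many values. *)
Definition covering_complexity : R :=
  xget 0 [set c : R | (exists2 U, U != 0%VS & c = covering_ratio U) /\
                      (forall U, U != 0%VS -> covering_ratio U <= c)]%classic.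

End Representations.

Arguments covering_ratio {F gT V} rho R U.
Arguments covering_complexity {F gT V} rho R.

Section SpecialLinear.
Variables (F : fieldType) (n : nat).

Record SL := MkSL { SLval :> 'M[F]_n; SL_det : \det SLval == 1 }.

HB.instance Definition _ := [isSub for SLval].
HB.instance Definition _ := [Choice of SL by <:].

Fact SL_one_subproof : \det (1%:M : 'M[F]_n) == 1.
Proof. by rewrite det1. Qed.

Fact SL_mul_subproof (g h : SL) : \det (g *m h) == 1.
Proof. by rewrite det_mulmx (eqP (SL_det g)) (eqP (SL_det h)) mulr1. Qed.

Fact SL_inv_subproof (g : SL) : \det (invmx g) == 1.
Proof. by rewrite det_inv (eqP (SL_det g)) invr1. Qed.

Definition SL_one := MkSL SL_one_subproof.
Definition SL_mul g h := MkSL (SL_mul_subproof g h).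
Definition SL_inv g := MkSL (SL_inv_subproof g).

Lemma SL_unitmx (g : SL) : (g : 'M[F]_n) \in unitmx.
Proof. by rewrite unitmxE (eqP (SL_det g)) unitr1. Qed.

Fact SL_mulA : associative SL_mul.
Proof. by move=> x y z; apply: val_inj; rewrite /= mulmxA. Qed.
Fact SL_mul1g : left_id SL_one SL_mul.
Proof. by move=> x; apply: val_inj; rewrite /= mul1mx. Qed.
Fact SL_mulg1 : right_id SL_one SL_mul.
Proof. by move=> x; apply: val_inj; rewrite /= mulmx1. Qed.
Fact SL_mulVg : left_inverse SL_one SL_inv SL_mul.
Proof. by move=> x; apply: val_inj; rewrite /= mulVmx // SL_unitmx. Qed.
Fact SL_mulgV : right_inverse SL_one SL_inv SL_mul.
Proof. by move=> x; apply: val_inj; rewrite /= mulmxV // SL_unitmx. Qed.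

HB.instance Definition _ :=
  isGroup.Build SL SL_mulA SL_mul1g SL_mulg1 SL_mulVg SL_mulgV.

End SpecialLinear.

(* The symmetric algebra of F^n.+1 is the polynomial algebra on its standard
   basis, the variable 'X_i standing for the i-th basis vector; the k-th
   symmetric power is its homogeneous part of degree k, and g acts by the
   algebra morphism sending 'X_i to the i-th column of g. *)
Section SymmetricPower.
Variables (F : fieldType) (n k : nat).
Implicit Types (g h : 'M[F]_n.+1) (p : mpoly n.+1 F).

Definition subst_mx g p : mpoly n.+1 F :=
  comp_mpoly
    [tuple \sum_(j < n.+1) g j i *: mpolyX F (mnm1 j) | i < n.+1] p.

Fact subst_mx_is_linear g : linear (subst_mx g).
Proof. exact: linearP. Qed.
Fact subst_mx_is_multiplicative g : monoid_morphism (subst_mx g).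
Proof. by split=> [|p q]; [exact: comp_mpoly1 | exact: rmorphM]. Qed.
HB.instance Definition _ g :=
  GRing.isLinear.Build F _ _ _ (subst_mx g) (subst_mx_is_linear g).
HB.instance Definition _ g := GRing.isMonoidMorphism.Build _ _ (subst_mx g)
  (subst_mx_is_multiplicative g).

Lemma subst_mxXU g i :
  subst_mx g (mpolyX F (mnm1 i)) = \sum_j g j i *: mpolyX F (mnm1 j).
Proof. by rewrite /subst_mx comp_mpolyXU -tnth_nth tnth_mktuple. Qed.

Lemma subst_mxX g m : subst_mx g (mpolyX F m) =
  \prod_i subst_mx g (mpolyX F (mnm1 i)) ^+ m i.
Proof.
rewrite {1}/subst_mx comp_mpolyX.
by apply: eq_bigr => i _; rewrite subst_mxXU tnth_mktuple.
Qed.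

Lemma subst_mx_mul g h p : subst_mx (g *m h) p = subst_mx g (subst_mx h p).
Proof.
rewrite [p]mpolyE [LHS]raddf_sum [subst_mx h _]raddf_sum [RHS]raddf_sum.
apply: eq_bigr => m _.
rewrite /= [LHS]linearZ [subst_mx h _]linearZ [RHS]linearZ /=; congr (_ *: _).
rewrite !subst_mxX rmorph_prod; apply: eq_bigr => i _.
rewrite rmorphXn /=; congr (_ ^+ _); rewrite !subst_mxXU raddf_sum /=.
under eq_bigr do rewrite mxE scaler_suml.
rewrite exchange_big; apply: eq_bigr => l _ /=.
rewrite linearZ /= subst_mxXU scaler_sumr.
by apply: eq_bigr => j _; rewrite scalerA mulrC.
Qed.

Lemma subst_mx1 p : subst_mx 1%:M p = p.
Proof.
rewrite -[RHS]comp_mpoly_id /subst_mx; congr (comp_mpoly _ _).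
apply: eq_from_tnth => i; rewrite !tnth_mktuple (bigD1 i) //= big1 ?addr0.
  by rewrite mxE eqxx scale1r.
by move=> j ji; rewrite mxE (negbTE ji) scale0r.
Qed.

Fact subst_mx_homog g (p : dhomog n.+1 F k) :
  subst_mx g p \is ishomog1 k (@mdeg n.+1).
Proof.
have /dhomogP hp := dhomog_is_dhomog p.
rewrite (mpolyE p) raddf_sum /= big_seq rpred_sum //= => m mp.
rewrite linearZ rpredZ //= subst_mxX.
have /= := hp m mp; rewrite mdegE => <-.
apply: (big_ind2 (fun q d => q \is ishomog1 d (@mdeg n.+1))).
- exact: dhomog1.
- by move=> q d q' d'; exact: dhomogM.
move=> i _; rewrite -[X in ishomog1 X]mul1n; apply: dhomogMn.
rewrite subst_mxXU; apply: rpred_sum => j _; apply: rpredZ.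
by rewrite dhomogX /= mdeg1.
Qed.

Definition sym_act g (p : dhomog n.+1 F k) : dhomog n.+1 F k :=
  DHomog (subst_mx_homog g p).

Fact sym_act_is_linear g : linear (sym_act g).
Proof. by move=> a p q; apply: val_inj; rewrite /= linearP. Qed.

HB.instance Definition _ g :=
  GRing.isLinear.Build F _ _ _ (sym_act g) (sym_act_is_linear g).

Fact sym_act_rep1 : linfun (sym_act (1%g : SL F n.+1)) = \1%VF.
Proof.
apply/lfunP => p; rewrite lfunE id_lfunE /=; apply: val_inj.
exact: subst_mx1.
Qed.

Fact sym_act_repM (g h : SL F n.+1) :
  linfun (sym_act (g * h)%g) = (linfun (sym_act g) \o linfun (sym_act h))%VF.
Proof.
apply/lfunP => p; rewrite comp_lfunE !lfunE /=; apply: val_inj.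
exact: subst_mx_mul.
Qed.

Definition sym_rep : representation (SL F n.+1) (dhomog n.+1 F k) :=
  Representation sym_act_rep1 sym_act_repM.

End SymmetricPower.
Arguments sym_rep F n k : clear implicits.

(* The exterior power is realised inside the tensor power as the space of
   alternating tensors, which is legitimate in characteristic 0. *)
Section ExteriorPower.
Variables (F : fieldType) (n m : nat).
Implicit Types (g h : 'M[F]_n).

(* t j is the coefficient of e_(j 0) (x) ... (x) e_(j m-1) in t. *)
Definition tensor := {ffun {ffun 'I_m -> 'I_n} -> F^o}.
HB.instance Definition _ := Vector.on tensor.
Implicit Type t : tensor.

Definition tensor_act g t : tensor :=
  [ffun i : {ffun 'I_m -> 'I_n} =>
     \sum_(j : {ffun 'I_m -> 'I_n}) (\prod_(a < m) g (i a) (j a)) * t j].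

Fact tensor_act_is_linear g : linear (tensor_act g).
Proof.
move=> a t u; apply/ffunP => i; rewrite !ffunE scaler_sumr -big_split /=.
apply: eq_bigr => j _; rewrite !ffunE mulrDr; congr (_ + _).
by rewrite /GRing.scale /= mulrCA.
Qed.
HB.instance Definition _ g :=
  GRing.isLinear.Build F _ _ _ (tensor_act g) (tensor_act_is_linear g).

Lemma tensor_act1 t : tensor_act 1%:M t = t.
Proof.
apply/ffunP => i; rewrite !ffunE (bigD1 i) //= big1 ?mul1r => [|a _];
  last by rewrite mxE eqxx.
rewrite big1 ?addr0 // => j ji.
have [a ne] : exists a, i a != j a.
  apply/existsP; apply: contraNT ji; rewrite negb_exists => /forallP e.
  by apply/eqP/ffunP => a; apply/esym/eqP; move: (e a); rewrite negbK.
by rewrite (bigD1 a) //= mxE (negbTE ne) !mul0r.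
Qed.

Lemma tensor_actM g h t : tensor_act (g *m h) t = tensor_act g (tensor_act h t).
Proof.
apply/ffunP => i; rewrite !ffunE.
under eq_bigr => j _.
  under eq_bigr do rewrite mxE.
  rewrite bigA_distr_bigA mulr_suml; over.
rewrite exchange_big /=; apply: eq_bigr => l _; rewrite ffunE mulr_sumr.
by apply: eq_bigr => j _; rewrite big_split /= mulrA.
Qed.

Definition permute_tensor (s : 'S_m) t : tensor :=
  [ffun j : {ffun 'I_m -> 'I_n} => t [ffun a => j (s a)]].

Fact permute_tensor_is_linear s : linear (permute_tensor s).
Proof. by move=> a t u; apply/ffunP => i; rewrite !ffunE. Qed.
HB.instance Definition _ s :=
  GRing.isLinear.Build F _ _ _ (permute_tensor s) (permute_tensor_is_linear s).

Definition alt_tensors : {vspace tensor} :=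
  (\bigcap_(s : 'S_m) lker (linfun (permute_tensor s) - (-1) ^+ s *: \1%VF))%VS.

Lemma alt_tensorsP t :
  reflect (forall s : 'S_m, permute_tensor s t = (-1) ^+ s *: t)
          (t \in alt_tensors).
Proof.
rewrite /alt_tensors memvE.
apply: (iffP subv_bigcapP) => [H s|H s _].
  have := H s isT; rewrite -memvE memv_ker add_lfunE opp_lfunE.
  by rewrite scale_lfunE id_lfunE lfunE subr_eq0 => /eqP.
rewrite -memvE memv_ker add_lfunE opp_lfunE scale_lfunE id_lfunE lfunE.
by rewrite /= H subrr.
Qed.

Lemma permute_tensor_act s g t :
  permute_tensor s (tensor_act g t) = tensor_act g (permute_tensor s t).
Proof.
apply/ffunP => i; rewrite !ffunE /=.
pose p (s : 'S_m) (j : {ffun 'I_m -> 'I_n}) := [ffun a => j (s a)].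
have pK : cancel (p s) (p s^-1%g).
  by move=> j; apply/ffunP => a; rewrite !ffunE permKV.
have pK' : cancel (p s^-1%g) (p s).
  by move=> j; apply/ffunP => a; rewrite !ffunE permK.
rewrite (reindex (p s)) /=; last by exists (p s^-1%g) => ? _.
apply: eq_bigr => j _; rewrite ffunE; congr (_ * _).
rewrite [RHS](reindex s) /=; last first.
  by apply: onW_bij; exists s^-1%g => a; rewrite ?permK ?permKV.
by apply: eq_bigr => a _; rewrite !ffunE.
Qed.

Lemma tensor_act_alt g t :
  t \in alt_tensors -> tensor_act g t \in alt_tensors.
Proof.
move=> /alt_tensorsP H; apply/alt_tensorsP => s.
by rewrite permute_tensor_act H linearZ.
Qed.

Definition ext_act g (w : subvs_of alt_tensors) : subvs_of alt_tensors :=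
  vsproj alt_tensors (tensor_act g (vsval w)).

Fact ext_act_is_linear g : linear (ext_act g).
Proof. by move=> a t u; rewrite /ext_act !linearP. Qed.
HB.instance Definition _ g :=
  GRing.isLinear.Build F _ _ _ (ext_act g) (ext_act_is_linear g).

Lemma vsval_ext_act g w : vsval (ext_act g w) = tensor_act g (vsval w).
Proof. by rewrite /ext_act vsprojK // tensor_act_alt ?subvsP. Qed.

Fact ext_act_rep1 : linfun (ext_act (1%g : SL F n)) = \1%VF.
Proof.
apply/lfunP => w; rewrite lfunE id_lfunE; apply: val_inj.
by rewrite /= vsval_ext_act tensor_act1.
Qed.

Fact ext_act_repM (g h : SL F n) :
  linfun (ext_act (g * h)%g) = (linfun (ext_act g) \o linfun (ext_act h))%VF.
Proof.
apply/lfunP => w; rewrite comp_lfunE !lfunE; apply: val_inj.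
by rewrite /= !vsval_ext_act tensor_actM.
Qed.

Definition ext_rep : representation (SL F n) (subvs_of alt_tensors) :=
  Representation ext_act_rep1 ext_act_repM.

(* v_0 /\ ... /\ v_(m-1), that is, the sum of sgn(s) v_(s 0) (x) ... (x)
   v_(s (m-1)) over all permutations s. *)
Definition wedge (v : 'I_m -> 'cV[F]_n) : tensor :=
  [ffun j : {ffun 'I_m -> 'I_n} => \det (\matrix_(a, b) v b (j a) 0)].

Lemma wedge_alt_tensors v : wedge v \in alt_tensors.
Proof.
apply/alt_tensorsP => s; apply/ffunP => j; rewrite !ffunE.
rewrite /GRing.scale /= -det_perm -det_mulmx -row_permE; congr (\det _).
by apply/matrixP => a b; rewrite !mxE ffunE.
Qed.

Lemma tensor_act_wedge g v : tensor_act g (wedge v) = wedge (fun b => g *m v b).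
Proof.
apply/ffunP => i; rewrite !ffunE.
under eq_bigr do rewrite ffunE mulr_sumr.
rewrite exchange_big /=; apply: eq_bigr => s _.
under eq_bigr do rewrite mulrCA; rewrite -mulr_sumr; congr (_ * _).
under [RHS]eq_bigr do rewrite mxE mxE.
rewrite bigA_distr_bigA; apply: eq_bigr => j _.
by rewrite -big_split; apply: eq_bigr => a _; rewrite /= mxE.
Qed.

End ExteriorPower.
Arguments ext_rep F n m : clear implicits.
Arguments alt_tensors F n m : clear implicits.

(* Main.v *)
Require Import Defs.
From HB Require Import structures.
From mathcomp Require Import all_boot all_order all_algebra all_fingroup.
From mathcomp Require mpoly.
From mathcomp Require Import all_classical all_reals all_analysis.
From mathcomp Require Import complex.
From mathcomp Require Import zify ring lra.

Set Implicit Arguments.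
Unset Strict Implicit.
Unset Printing Implicit Defensive.

Import Order.TTheory GRing.Theory Num.Theory.
Import numFieldNormedType.Exports.
Import -(notations) mpoly.

Local Open Scope ring_scope.
Local Open Scope classical_set_scope.

(** In both cases the group-additive diameter of [U] can be computed exactly.

    Write [V] as the degree [n] part of the symmetric algebra of C^(n+1), or of
    the exterior algebra of C^(2n); both have dimension 'C(2n, n). Take for [U]
    the degree [n] part of the ideal generated by one basis vector [e], so that
    its dimension is half that of [V]: 'C(2n-1, n) in the first case; in the
    second, complementing the sets of indices exchanges the basis vectors of
    [V] that involve [e] and those that do not. A translate [g U] is the degree
    [n] part of the ideal generated by [g e], and a sum of translates is that
    of the ideal generated by the vectors [g_i e]. Hence the sum depends only on
    the span of the [g_i e].

    - If there are at most [n] translates, some linear map [A] to C (symmetric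
      case) or C^n (exterior case) has a right inverse and kills every [g_i e]
      ([annihilator_mx]). Evaluating polynomials at the point [A], resp.
      pushing n-vectors forward to the line Lambda^n C^n, is a linear form that
      vanishes on the translates but not on [V] ([sym_half_not_covered],
      [ext_half_not_covered]).
    - The group moves [e] to any basis vector ([SL_col]), and the ideal of
      [n + 1] distinct basis vectors contains all of [V]: a monomial of positive
      degree involves some variable, and an [n]-subset of 2n indices meets every
      set of [n + 1] of them ([sym_half_covered], [ext_half_covered]).

    So the diameter is [n + 1], while 4^n / (2n + 1) <= 'C(2n, n) <= 4^n gives
    ln (dim V) = 2 n ln 2 + O(ln n): the diameter is ln (dim V) / (2 ln 2) up to
    a factor 1 + o(1) ([central_error_cvg0]), and it is at least that number.
    Since dim V / dim U = 2, the ratio R(V, U) is half the diameter. Finally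
    C(V) bounds R(V, U) because the maximum that defines it is attained
    ([covering_ratio_le_complexity]). *)

(** * Group-additive diameters *)

Section Diameter.
Variables (F : fieldType) (gT : groupType) (V : vectType F).
Variable rho : representation gT V.
Implicit Type U : {vspace V}.

Lemma covered_by_seq U (s : seq gT) :
  (\sum_(g <- s) (rho g @: U))%VS = fullv ->
  covered_by_translates rho U (size s).
Proof.
move=> sV; exists (tnth (in_tuple s)).
by rewrite -sV big_tnth.
Qed.

Lemma diam_plusE U d :
  covered_by_translates rho U d ->
  (forall r, (r < d)%N -> ~ covered_by_translates rho U r) ->
  diam_plus rho U = d.
Proof.
move=> cov ncov; rewrite /diam_plus; case: pselect => [h|]; last first.
  by case; exists d; apply/asboolP.
case: ex_minnP => e /asboolP ecov emin; apply/eqP; rewrite eqn_leq.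
rewrite emin ?andbT; last exact/asboolP.
by rewrite leqNgt; apply/negP => /ncov.
Qed.

(** Scan the translates and keep one only if it enlarges the sum of those kept
    so far: each one kept raises the dimension by at least 1. *)
Lemma thin_translates U (s : seq gT) : exists s' : seq gT,
  (\sum_(g <- s') (rho g @: U) = \sum_(g <- s) (rho g @: U))%VS /\
  (size s' <= \dim (\sum_(g <- s) (rho g @: U)))%N.
Proof.
elim: s => [|g s [s' [eqs les]]].
  by exists [::]; rewrite !big_nil.
rewrite big_cons; set W := BIG_F in eqs les *; rewrite -eqs in les *.
set S := (\sum_(g <- s') (rho g @: U))%VS in eqs les *.
have [gS|gS] := boolP (rho g @: U <= S)%VS.
  exists s'; rewrite (_ : (_ + S)%VS = S) //.
  by apply/addv_idPr.
exists (g :: s'); rewrite big_cons; split=> //=.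
apply: leq_ltn_trans les _.
rewrite ltnNge; apply: contra gS => le_dim.
have /eqP -> : S == (rho g @: U + S)%VS by rewrite eqEdim addvSr.
exact: addvSl.
Qed.

Lemma diam_plus_le_dim U : (diam_plus rho U <= \dim (fullv : {vspace V}))%N.
Proof.
rewrite /diam_plus; case: pselect => // h.
case: ex_minnP => d /asboolP [g gV] dmin.
have [s []] := thin_translates U [seq g i | i : 'I_d].
rewrite big_image /= gV => sV; apply: leq_trans.
by apply: dmin; apply/asboolP; exact: covered_by_seq.
Qed.

(** The diameter and the dimension of a subspace are both at most the dimension
    of [V], so the covering ratio takes finitely many values and the maximum
    defining the covering complexity exists. *)
Lemma covering_ratio_le_complexity (R : realType) U :
  U != 0%VS -> covering_ratio rho R U <= covering_complexity rho R.
Proof.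
move=> U0; set d := \dim (fullv : {vspace V}).
pose ratio (p : 'I_d.+1 * 'I_d.+1) : R :=
  p.1%:R / (Num.ceil (d%:R / p.2%:R : R))%:~R.
pose index W := (inord (diam_plus rho W), inord (\dim W)) : 'I_d.+1 * 'I_d.+1.
have ratioE W : covering_ratio rho R W = ratio (index W).
  by rewrite /ratio /= !inordK // ltnS ?diam_plus_le_dim ?dimvS ?subvf.
pose attained p :=
  `[< exists2 W, W != 0%VS & ratio p = covering_ratio rho R W >].
have attU : attained (index U) by apply/asboolP; exists U.
rewrite /covering_complexity; case: xgetP => [c _ [_]|noc]; first exact.
case: (@Order.TotalTheory.arg_maxP _ _ _ (index U) attained ratio attU).
move=> p /asboolP[W W0 pW] pmax.
case: (noc (ratio p)); split; first by exists W.
move=> W' W'0; rewrite ratioE; apply: pmax; apply/asboolP.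
by exists W'.
Qed.

End Diameter.

(** * Linear maps killing few vectors, and moving basis vectors *)

(** The rows of [A] are [d] independent linear forms on which the [r] columns of
    [M] vanish; such forms exist since the forms vanishing on [r] vectors make
    up a space of dimension at least [n - r]. The right inverse [B] expresses
    their independence. *)
Lemma annihilator_mx (F : fieldType) (n r d : nat) (M : 'M[F]_(n, r)) :
  (d + r <= n)%N ->
  exists (A : 'M[F]_(d, n)) (B : 'M[F]_(n, d)), A *m M = 0 /\ A *m B = 1%:M.
Proof.
move=> le_n; set K := row_base (kermx M).
have ledK : (d <= \rank (kermx M))%N.
  by rewrite mxrank_ker leq_subRL ?rank_leq_row // addnC (leq_trans _ le_n) //
     leq_add2l rank_leq_col.
have [B KB] := row_freeP (row_base_free (kermx M)).
exists (pid_mx d *m K), (B *m pid_mx d); split.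
  rewrite -mulmxA (_ : K *m M = 0) ?mulmx0 //.
  by apply/sub_kermxP; rewrite eq_row_base.
by rewrite mulmxA -(mulmxA _ K) KB mulmx1 pid_mx_id // pid_mx_1.
Qed.

(** The permutation matrix of a transposition has determinant -1; negating
    the column that does not matter brings it back into SL. *)
Lemma SL_col (F : fieldType) (n : nat) (x i : 'I_n) :
  exists g : SL F n, forall j, g j x = (j == i)%:R.
Proof.
(* The sign sits in column i, so that column x is affected only if x = i, when
   the sign is 1. *)
pose d : 'rV[F]_n := \row_j (if j == i then (-1) ^+ (x != i) else 1).
have detg : \det (perm_mx (tperm x i) *m diag_mx d) == 1 :> F.
  rewrite det_mulmx det_perm det_diag (bigD1 i) //= big1 ?mulr1.
    by rewrite mxE eqxx odd_tperm -signr_addb addbb.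
  by move=> j /negbTE ji; rewrite mxE ji.
exists (MkSL detg) => j; rewrite /= mul_mx_diag !mxE.
rewrite (_ : (if _ then _ else _) = 1) ?mulr1; last by case: eqVneq.
by rewrite (canF_eq (tpermK x i)) tpermL.
Qed.

(** * The symmetric power *)

Section SymmetricHalf.
Variables (F : fieldType) (n d : nat).
Local Notation Sym k := (dhomog n.+1 F k).
Local Notation var i := (mpolyX F (mnm1 i)).
Implicit Types (i j : 'I_n.+1) (p : Sym d).

Fact mulX_homog i p : var i * p \is ishomog1 d.+1 (@mdeg n.+1).
Proof.
rewrite -[X in ishomog1 X]add1n; apply: dhomogM; last exact: dhomog_is_dhomog.
by rewrite dhomogX /= mdeg1.
Qed.

Definition mulX i p : Sym d.+1 := DHomog (mulX_homog i p).

Fact mulX_is_linear i : linear (mulX i).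
Proof. by move=> a p q; apply: val_inj; rewrite /= mulrDr scalerAr. Qed.
HB.instance Definition _ i :=
  GRing.isLinear.Build F _ _ _ (mulX i) (mulX_is_linear i).

Definition sym_half : {vspace Sym d.+1} := limg (linfun (mulX ord0)).

Lemma dim_sym k : \dim (fullv : {vspace Sym k}) = 'C(k + n, k).
Proof. by rewrite dimvf. Qed.

Lemma dim_sym_half : \dim sym_half = 'C(d + n, d).
Proof.
rewrite -dim_sym; apply: limg_dim_eq; apply/eqP; rewrite capfv.
apply/lker0P => p q; rewrite !lfunE => /(congr1 val) /= pq.
apply/val_inj; apply: (mulfI _ pq).
apply/eqP => /(congr1 (mcoeff (mnm1 ord0))).
by rewrite mcoeffXU mcoeff0 eqxx => /eqP; rewrite oner_eq0.
Qed.

Local Notation rho := (sym_rep F n d.+1).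

(** [g] sends the first variable to the linear form with coefficients
    [g j ord0], which divides every element of the translate by [g]. *)
Lemma meval_translate (g : SL F n.+1) (v : 'I_n.+1 -> F) (w : Sym d.+1) :
  \sum_j g j ord0 * v j = 0 -> w \in (rho g @: sym_half)%VS -> meval v w = 0.
Proof.
move=> gv /memv_imgP[u /memv_imgP[p _ ->] ->]; rewrite !lfunE /=.
rewrite [subst_mx _ _]rmorphM /= mevalM subst_mxXU raddf_sum /=.
rewrite [X in X * _](_ : _ = 0) ?mul0r //.
by rewrite -[RHS]gv; apply: eq_bigr => j _; rewrite mevalZ mevalXU.
Qed.

Lemma sym_half_not_covered r :
  (r < n.+1)%N -> ~ covered_by_translates rho sym_half r.
Proof.
move=> rn [g gV].
have [A [B [AM AB]]] :=
  @annihilator_mx F n.+1 r 1 (\matrix_(j, a) g a j ord0) rn.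
pose v j := A ord0 j.
(* The power of the j-th variable does not vanish at v. *)
have [j vj] : exists j, v j != 0.
  apply/existsP; apply: contraT; rewrite negb_exists => /forallP v0.
  have /matrixP/(_ ord0 ord0) := AB; rewrite !mxE big1 /= => [/eqP|j _].
    by rewrite eq_sym oner_eq0.
  by have := v0 j; rewrite negbK /v => /eqP ->; rewrite mul0r.
have hw : var j ^+ d.+1 \is ishomog1 d.+1 (@mdeg n.+1).
  by rewrite -[X in ishomog1 X]mul1n; apply: dhomogMn; rewrite dhomogX /= mdeg1.
have /memv_sumP[u uU uw] :
    DHomog hw \in (\sum_(a < r) (rho (g a) @: sym_half))%VS.
  by rewrite gV memvf.
have : meval v (DHomog hw) = 0.
  rewrite uw !raddf_sum big1 //= => a _; apply: (@meval_translate (g a)) => //.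
    have /matrixP/(_ ord0 a) := AM; rewrite [LHS]mxE [RHS]mxE => AMa.
    rewrite -[RHS]AMa.
    by apply: eq_bigr => l _; rewrite mxE mulrC.
  exact: uU.
by rewrite /= rmorphXn /= mevalXU => /eqP; rewrite expf_eq0 (negbTE vj).
Qed.

Lemma sym_half_covered : covered_by_translates rho sym_half n.+1.
Proof.
have [g gE] := fin_all_exists (@SL_col F n.+1 ord0).
exists g; apply/eqP; rewrite eqEsubv subvf /=; set S := (\sum_(i < _) _)%VS.
have gS i p : mulX i p \in S.
  apply: (subvP (sumv_sup i (isT : true) (subvv _))).
  (* g i sends the first variable to the i-th one. *)
  pose q := sym_act (g i)^-1%g p.
  have -> : mulX i p = rho (g i) (linfun (mulX ord0) q).
    apply: val_inj; rewrite !lfunE /= [subst_mx _ _]rmorphM /= subst_mxXU.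
    rewrite (bigD1 i) //= big1 => [|j /negbTE ji].
      rewrite gE eqxx scale1r addr0 -subst_mx_mul.
      by rewrite mulmxV ?SL_unitmx // subst_mx1.
    by rewrite gE ji scale0r.
  by rewrite memv_img // memv_img ?memvf.
apply/subvP => p _.
have -> : p = \sum_(m <- msupp p) mcoeff m p *: insubd 0 (mpolyX F m).
  apply: val_inj; rewrite raddf_sum /= [LHS]mpolyE; apply: eq_big_seq => m mp.
  rewrite insubdK // -topredE /= dhomogX.
  by have /dhomogP/(_ m mp) := dhomog_is_dhomog p => ->.
rewrite big_seq; apply: rpred_sum => m mp; apply: rpredZ.
have degm : mdeg m = d.+1 by have /dhomogP/(_ m mp) := dhomog_is_dhomog p.
have [i mi] : exists i, m i != 0%N.
  apply/existsP; apply: contraT; rewrite negb_exists => /forallP m0.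
  have := degm; rewrite mdegE big1 // => i _.
  by have := m0 i; rewrite negbK => /eqP.
have hq : mpolyX F (mnm_sub m (mnm1 i)) \is ishomog1 d (@mdeg n.+1).
  by rewrite dhomogX /= -eqSS -degm -addn1 -(mdeg1 i) -mdegD submK // lep1mP.
have -> : insubd 0 (mpolyX F m) = mulX i (DHomog hq); last exact: gS.
apply: val_inj; rewrite /= insubdK; last first.
  by rewrite -topredE /= dhomogX; apply/eqP.
by rewrite -mpolyXD addmC submK // lep1mP.
Qed.

End SymmetricHalf.

(** * The exterior power *)

Section ExteriorHalf.
Variables (F : numFieldType) (n m : nat).
Local Notation Alt := (alt_tensors F n m).
Implicit Types (A B : {set 'I_n}) (t : tensor F n m) (j : {ffun 'I_m -> 'I_n}).

(** Swapping two equal indices changes the sign, and 2 is invertible. *)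
Lemma alt_tensor_repeat t j : t \in Alt -> ~~ injectiveb j -> t j = 0.
Proof.
move=> /alt_tensorsP tA /injectivePn[a [b ab jab]].
have /ffunP/(_ j) := tA (tperm a b).
rewrite !ffunE odd_tperm ab expr1 scaleN1r.
have -> : [ffun c => j (tperm a b c)] = j.
  by apply/ffunP => c; rewrite ffunE; case: tpermP => // ->.
by move/eqP; rewrite -subr_eq0 opprK -mulr2n mulrn_eq0 => /eqP.
Qed.

Definition std v : 'cV[F]_n := delta_mx v 0.

Lemma wedge_stdE (f : 'I_m -> 'I_n) j :
  wedge (fun b => std (f b)) j = \det (\matrix_(a, b) (j a == f b)%:R) :> F.
Proof.
by rewrite ffunE; congr (\det _); apply/matrixP => a b; rewrite !mxE eqxx andbT.
Qed.

Variable x0 : 'I_n.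

(** The value at positions past the size of [A] is [x0], hence arbitrary: this
    is used only when [A] has [m] elements. *)
Definition listing (A : {set 'I_n}) : {ffun 'I_m -> 'I_n} :=
  [ffun a : 'I_m => nth x0 (enum A) a].

Definition set_wedge (A : {set 'I_n}) : tensor F n m :=
  wedge (fun b => std (listing A b)).

Lemma listing_inj A : #|A| = m -> injective (listing A).
Proof.
move=> Am a b; rewrite !ffunE => /eqP.
by rewrite nth_uniq ?enum_uniq -?cardE ?Am // => /eqP/val_inj.
Qed.

Lemma listing_mem A a : #|A| = m -> listing A a \in A.
Proof. by move=> Am; rewrite ffunE -mem_enum mem_nth // -cardE Am. Qed.

Lemma listingP A i : #|A| = m -> i \in A -> exists a, listing A a = i.
Proof.
move=> Am; rewrite -mem_enum => /(nthP x0)[a]; rewrite -cardE Am => am <-.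
by exists (Ordinal am); rewrite ffunE.
Qed.

(** The wedges of basis vectors and the coefficients at increasing lists of
    indices are dual families: when [A] differs from [B], some element of [A] is
    missing from [B] and gives a zero column. *)
Lemma set_wedge_listing A B : #|A| = m -> #|B| = m ->
  set_wedge A (listing B) = (A == B)%:R.
Proof.
move=> Am Bm; rewrite /set_wedge wedge_stdE; have [<-|neAB] := eqVneq.
  rewrite (_ : \matrix_(_, _) _ = 1%:M) ?det1 //; apply/matrixP => a b.
  by rewrite !mxE (inj_eq (listing_inj Am)).
have [i iA iB] : exists2 i, i \in A & i \notin B.
  by apply/subsetPn; apply: contra neAB => sAB; rewrite eqEcard sAB Am Bm /=.
have [b bi] := listingP Am iA.
rewrite (expand_det_col _ b) big1 // => a _; rewrite mxE bi.
by rewrite (negbTE (memPn iB _ (listing_mem a Bm))) mul0r.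
Qed.

(** An index function either repeats a value or is a permutation of the listing
    of its image, so antisymmetry recovers all coefficients from those at
    listings. *)
Lemma alt_tensor_eq0 t : t \in Alt ->
  (forall A, #|A| = m -> t (listing A) = 0) -> t = 0.
Proof.
move=> tA t0; apply/ffunP => j; rewrite [RHS]ffunE.
have [/injectiveP injj|] := boolP (injectiveb j); last exact: alt_tensor_repeat.
pose A := [set j a | a : 'I_m].
have Am : #|A| = m by rewrite card_imset // card_ord.
have jA a : exists b, listing A b = j a by apply: listingP; rewrite ?imset_f.
have [s sE] := fin_all_exists jA.
have injs : injective s by move=> a b sab; apply: injj; rewrite -!sE sab.
have /ffunP/(_ (listing A)) := alt_tensorsP _ tA (perm injs).
rewrite !ffunE t0 // [RHS]scaler0 => <-; congr (t _).
by apply/ffunP => a; rewrite ffunE permE sE.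
Qed.

Lemma tensorZE a t j : (a *: t) j = a * t j.
Proof. by rewrite ffunE. Qed.

Lemma tensorBE t u j : (t - u) j = t j - u j.
Proof. by rewrite !ffunE. Qed.

Lemma alt_tensor_expand t : t \in Alt ->
  t = \sum_(A : {set 'I_n} | #|A| == m) (t (listing A) : F) *: set_wedge A.
Proof.
move=> tA; apply/eqP; rewrite -subr_eq0; apply/eqP; apply: alt_tensor_eq0.
  rewrite rpredB //; apply: rpred_sum => A _; apply: rpredZ.
  exact: wedge_alt_tensors.
move=> B Bm; rewrite tensorBE sum_ffunE (bigD1 B) ?Bm //= big1 => [|A /andP[]].
  by rewrite tensorZE set_wedge_listing // eqxx addr0 mulr1 subrr.
move=> /eqP Am AB; rewrite tensorZE set_wedge_listing // (negbTE AB).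
by rewrite mulr0.
Qed.

Definition ext_wedge A : subvs_of Alt :=
  vsproj Alt (set_wedge A).

Lemma vsval_ext_wedge A : vsval (ext_wedge A) = set_wedge A.
Proof. by rewrite vsprojK // wedge_alt_tensors. Qed.

Lemma ext_expand (w : subvs_of Alt) :
  w = \sum_(A : {set 'I_n} | #|A| == m)
        (vsval w (listing A) : F) *: ext_wedge A.
Proof.
apply: (can_inj vsvalK); rewrite [LHS]alt_tensor_expand ?subvsP // raddf_sum.
by apply: eq_bigr => A _; rewrite /= vsval_ext_wedge.
Qed.

Definition wedge_span (S : {set {set 'I_n}}) : {vspace subvs_of Alt} :=
  <<[seq ext_wedge A | A <- enum S]>>%VS.

Lemma dim_wedge_span (S : {set {set 'I_n}}) :
  {in S, forall A : {set 'I_n}, #|A| = m} -> \dim (wedge_span S) = #|S|.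
Proof.
move=> Sm; pose X := map_tuple ext_wedge (enum_tuple S).
suff /eqP : free X by rewrite size_tuple.
apply/freeP => c cX i0.
have /(congr1 (fun w : subvs_of Alt =>
  (vsval w : tensor F n m) (listing (enum_val i0)))) := cX.
rewrite raddf_sum sum_ffunE ffunE (bigD1 i0) //= big1 => [|i ii0].
  rewrite addr0 /= (nth_map (enum_val i0)) -?cardE //.
  rewrite -enum_val_nth vsval_ext_wedge tensorZE.
  by rewrite set_wedge_listing ?eqxx ?Sm ?enum_valP // mulr1.
rewrite /= (nth_map (enum_val i)) -?cardE //.
rewrite -enum_val_nth vsval_ext_wedge tensorZE.
rewrite set_wedge_listing ?Sm ?enum_valP //.
by rewrite (inj_eq enum_val_inj) (negbTE ii0) mulr0.
Qed.

Lemma mem_wedge_span (S : {set {set 'I_n}}) (w : subvs_of Alt) :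
  (forall A : {set 'I_n}, #|A| = m -> A \notin S -> vsval w (listing A) = 0) ->
  w \in wedge_span S.
Proof.
move=> w0; rewrite (ext_expand w); apply: rpred_sum => A /eqP Am.
have [AS|AS] := boolP (A \in S); last by rewrite w0 // scale0r mem0v.
by apply/rpredZ/memv_span/map_f; rewrite mem_enum.
Qed.

Lemma dim_ext : \dim (fullv : {vspace subvs_of Alt}) = 'C(n, m).
Proof.
pose S := [set A : {set 'I_n} | #|A| == m].
rewrite -[n in RHS]card_ord -card_draws -/S -dim_wedge_span; last first.
  by move=> A; rewrite inE => /eqP.
congr (\dim _); apply/esym/eqP; rewrite eqEsubv subvf; apply/subvP => w _.
by apply: mem_wedge_span => A; rewrite inE => ->; rewrite eqxx.
Qed.

(** The degree [m] part of the ideal generated by the basis vector [x0]. *)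
Definition ext_half : {vspace subvs_of Alt} :=
  wedge_span [set A : {set 'I_n} | (#|A| == m) && (x0 \in A)].

Lemma wedge_in_half (v : 'I_m -> 'cV[F]_n) b :
  v b = std x0 -> vsproj Alt (wedge v) \in ext_half.
Proof.
move=> vb; apply: mem_wedge_span => A Am; rewrite inE Am eqxx /= => x0A.
rewrite vsprojK ?wedge_alt_tensors // ffunE (expand_det_col _ b) big1 // => a _.
by rewrite mxE vb mxE (negbTE (memPn x0A _ (listing_mem a Am))) mul0r.
Qed.

Local Notation rho := (ext_rep F n m).

(** The map of m-th tensor powers induced by [A] from F^n to F^m, followed by
    the coefficient at the identity list of indices; on alternating tensors
    this is the map from Lambda^m F^n to the line Lambda^m F^m. *)
Definition contract (A : 'M[F]_(m, n)) (t : tensor F n m) : F :=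
  \sum_(j : {ffun 'I_m -> 'I_n}) (\prod_a A a (j a)) * t j.

Fact contract_is_linear (A : 'M[F]_(m, n)) : scalar (contract A).
Proof.
move=> c t u; rewrite /contract mulr_sumr -big_split; apply: eq_bigr => j _.
by rewrite !ffunE mulrDr mulrCA.
Qed.
HB.instance Definition _ (A : 'M[F]_(m, n)) :=
  GRing.isLinear.Build F _ _ _ (contract A) (contract_is_linear A).

(** The Cauchy-Binet expansion of the determinant of a product. *)
Lemma contract_wedge (A : 'M[F]_(m, n)) (v : 'I_m -> 'cV[F]_n) :
  contract A (wedge v) = \det (\matrix_(a, b) (A *m v b) a 0).
Proof.
rewrite /contract; under eq_bigr do rewrite ffunE mulr_sumr.
rewrite exchange_big /=; apply: eq_bigr => s _.
under eq_bigr do rewrite mulrCA; rewrite -mulr_sumr; congr (_ * _).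
under [RHS]eq_bigr do rewrite mxE mxE.
rewrite bigA_distr_bigA; apply: eq_bigr => j _.
by rewrite -big_split; apply: eq_bigr => a _; rewrite /= mxE.
Qed.

(** Each generator of the translate is a wedge with [g e] as a factor, where
    [e] is the basis vector [x0]; its image by [A] is a zero column. *)
Lemma contract_translate (A : 'M[F]_(m, n)) (g : SL F n) (w : subvs_of Alt) :
  A *m (g *m std x0) = 0 -> w \in (rho g @: ext_half)%VS ->
  contract A (vsval w) = 0.
Proof.
move=> Ag /memv_imgP[u uU ->].
suff /subvP/(_ _ uU) : (ext_half <=
    lker (linfun (contract A \o vsval) \o rho g))%VS.
  by rewrite memv_ker comp_lfunE !lfunE /= => /eqP.
apply/span_subvP => y /mapP[B]; rewrite mem_enum inE => /andP[/eqP Bm x0B] ->.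
have [b bx] := listingP Bm x0B.
rewrite memv_ker comp_lfunE !lfunE /= vsval_ext_act vsval_ext_wedge.
rewrite tensor_act_wedge contract_wedge (expand_det_col _ b) big1 // => a _.
by rewrite mxE bx Ag mxE mul0r.
Qed.

Lemma ext_half_not_covered r :
  (m + r <= n)%N -> ~ covered_by_translates rho ext_half r.
Proof.
move=> rn [g gV].
pose M := \matrix_(i, a) (g a : 'M[F]_n) i x0.
have [A [B [AM AB]]] := annihilator_mx M rn.
(* Contracting this wedge gives the determinant of A B = 1. *)
pose w := vsproj Alt (wedge (fun b => col b B)).
have /memv_sumP[u uU uw] : w \in (\sum_(a < r) (rho (g a) @: ext_half))%VS.
  by rewrite gV memvf.
have : contract A (vsval w) = 0.
  rewrite uw !raddf_sum big1 //= => a _; apply: (@contract_translate _ (g a)).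
    have <- : A *m col a M = 0 by rewrite colE mulmxA AM mul0mx.
    by congr (_ *m _); rewrite -colE; apply/colP => i; rewrite !mxE.
  exact: uU.
rewrite vsprojK ?wedge_alt_tensors // contract_wedge.
rewrite (_ : \matrix_(_, _) _ = A *m B).
  by rewrite AB det1 => /eqP; rewrite oner_eq0.
by apply/matrixP => a b; rewrite mxE colE mulmxA -colE mxE.
Qed.

(** The translates chosen generate the ideal of [r] distinct basis vectors;
    by counting, every m-subset of the indices contains one of theirs. *)
Lemma ext_half_covered r (f : 'I_r -> 'I_n) : injective f ->
  (n < m + r)%N -> covered_by_translates rho ext_half r.
Proof.
move=> injf nr; have [g gE] := fin_all_exists (fun i => @SL_col F n x0 (f i)).
exists g; apply/eqP; rewrite eqEsubv subvf /=; set S := (\sum_(i < _) _)%VS.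
apply/subvP => w _; rewrite (ext_expand w); apply: rpred_sum => A /eqP Am.
apply: rpredZ.
have [i fiA] : exists i, f i \in A.
  apply/existsP; apply: contraT; rewrite negb_exists => /forallP fA.
  have : (#|A :|: [set f i | i : 'I_r]| <= n)%N.
    by rewrite -[X in (_ <= X)%N]card_ord max_card.
  rewrite cardsU (_ : A :&: _ = finset.set0) ?cards0 ?subn0; last first.
    apply/finset.setP => y; rewrite !inE.
    apply/negP => /andP[yA /imsetP[i _ yi]].
    by have := fA i; rewrite -yi yA.
  by rewrite Am card_imset // card_ord leqNgt nr.
have [b bE] := listingP Am fiA.
apply: (subvP (sumv_sup i (isT : true) (subvv _))).
pose gV := (g i)^-1%g : SL F n.
have -> : ext_wedge A =
    rho (g i) (vsproj Alt (wedge (fun b => gV *m std (listing A b)))).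
  apply: val_inj; rewrite lfunE /= vsval_ext_act vsval_ext_wedge.
  rewrite vsprojK ?wedge_alt_tensors // tensor_act_wedge; congr wedge.
  by apply/funext => c; rewrite mulmxA mulmxV ?SL_unitmx // mul1mx.
apply/memv_img/(@wedge_in_half _ b); rewrite bE.
rewrite (_ : std (f i) = g i *m std x0); last first.
  by rewrite -colE; apply/colP => l; rewrite !mxE gE eqxx andbT.
by rewrite mulmxA mulVmx ?SL_unitmx // mul1mx.
Qed.

End ExteriorHalf.

(** Complementing the index sets exchanges those that contain [x0] and those
    that do not. *)
Lemma dim_ext_half (F : numFieldType) (m : nat) (x0 : 'I_(2 * m)) :
  (2 * \dim (@ext_half F (2 * m) m x0) = 'C(2 * m, m))%N.
Proof.
pose S : {set {set 'I_(2 * m)}} := [set A : {set 'I_(2 * m)} | #|A| == m]%SET.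
pose P : {set {set 'I_(2 * m)}} := [set A : {set 'I_(2 * m)} | x0 \in A]%SET.
have cardC (A : {set 'I_(2 * m)}) : (#|~: A| == m) = (#|A| == m).
  by have := finset.cardsC A; rewrite card_ord; lia.
have SP : S :\: P = [set ~: A | A in S :&: P]%SET.
  apply/finset.setP => A; rewrite !inE; apply/andP/imsetP => [[xA Am]|[B]].
    by exists (~: A); rewrite ?finset.setCK // !inE cardC Am.
  by rewrite !inE => /andP[Bm xB] ->; rewrite !inE cardC xB Bm.
rewrite /ext_half dim_wedge_span; last by move=> A; rewrite inE => /andP[/eqP].
rewrite -[in RHS](card_ord (2 * m)) -card_draws -/S -(cardsID P S) SP.
rewrite (card_imset _ (can_inj (@finset.setCK _))) addnn -mul2n.
by congr (2 * _)%N; apply: eq_card => A; rewrite !inE.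
Qed.

(** * Central binomial coefficients *)

Lemma central_binS n :
  (n.+1 * 'C(2 * n.+1, n.+1) = 2 * ((2 * n).+1 * 'C(2 * n, n)))%N.
Proof.
have e : (2 * n.+1 = (2 * n).+2)%N by rewrite mulnS.
have d1 := mul_bin_diag (2 * n).+2 n.
have d2 := mul_bin_diag (2 * n).+1 n.
have s : ('C((2 * n).+1, n.+1) = 'C((2 * n).+1, n))%N.
  rewrite -(@bin_sub (2 * n).+1 n) ?leqW ?leq_pmull //.
  by congr ('C(_, _)); lia.
by rewrite /= s in d1 d2; rewrite e; nia.
Qed.

Lemma half_central_bin n : (2 * 'C(n + n.+1, n) = 'C(2 * n.+1, n.+1))%N.
Proof.
have -> : (2 * n.+1 = (n + n.+1).+1)%N by lia.
rewrite binS -(@bin_sub (n + n.+1) n.+1) ?leq_addl // addnK.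
by rewrite addnn mul2n.
Qed.

Lemma central_bin_le n : ('C(2 * n, n) <= 4 ^ n)%N.
Proof.
elim: n => // n IH; have := central_binS n; rewrite expnS; nia.
Qed.

Lemma central_bin_ge n : (4 ^ n <= (2 * n).+1 * 'C(2 * n, n))%N.
Proof.
elim: n => // n IH; have := central_binS n; rewrite expnS; nia.
Qed.

Lemma central_bin_ge2 n : (2 ^ n <= 'C(2 * n, n))%N.
Proof.
elim: n => // n IH; have := central_binS n; rewrite expnS; nia.
Qed.

Section Asymptotics.
Variable R : realType.

(** The relative error of ln 'C(2n, n) / (2 ln 2) as an estimate of [n + 1];
    the value at 0 is junk, since the logarithm vanishes there. *)
Definition central_error (n : nat) : R :=
  n.+1%:R * (2 * ln 2) / ln ('C(2 * n, n)%:R) - 1.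

Lemma ln2_gt0 : 0 < ln 2 :> R.
Proof. by rewrite ln_gt0 // ltr1n. Qed.

Lemma natr_bin_gt0 n : 0 < ('C(2 * n, n)%:R : R).
Proof. by rewrite ltr0n bin_gt0 leq_pmull. Qed.

Lemma ln_central_bin_le n : ln ('C(2 * n, n)%:R) <= n%:R * (2 * ln 2) :> R.
Proof.
have <- : ln (4 ^ n)%:R = n%:R * (2 * ln 2) :> R.
  by rewrite -[4%N]/(2 ^ 2)%N -expnM natrX lnXn // -[LHS]mulr_natl natrM; ring.
rewrite ler_ln ?posrE ?natr_bin_gt0 ?ltr0n ?expn_gt0 //.
by rewrite ler_nat central_bin_le.
Qed.

Lemma ln_central_bin_ge n :
  n%:R * (2 * ln 2) <= ln ((2 * n).+1%:R) + ln ('C(2 * n, n)%:R) :> R.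
Proof.
have <- : ln (4 ^ n)%:R = n%:R * (2 * ln 2) :> R.
  by rewrite -[4%N]/(2 ^ 2)%N -expnM natrX lnXn // -[LHS]mulr_natl natrM; ring.
rewrite -lnM ?posrE ?natr_bin_gt0 ?ltr0n // -natrM.
rewrite ler_ln ?posrE ?ltr0n ?muln_gt0 ?expn_gt0 //=; last first.
  by rewrite bin_gt0 leq_pmull.
by rewrite ler_nat central_bin_ge.
Qed.

Lemma ln_central_bin_ge2 n : n%:R * ln 2 <= ln ('C(2 * n, n)%:R) :> R.
Proof.
rewrite mulr_natl -lnXn // -natrX.
rewrite ler_ln ?posrE ?natr_bin_gt0 ?ltr0n ?expn_gt0 //.
by rewrite ler_nat central_bin_ge2.
Qed.

Lemma ln_central_bin_gt0 n : (0 < n)%N -> 0 < ln ('C(2 * n, n)%:R) :> R.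
Proof.
move=> n0; apply: lt_le_trans (ln_central_bin_ge2 n).
by rewrite mulr_gt0 ?ln2_gt0 ?ltr0n.
Qed.

Lemma central_error_ge0 n : (0 < n)%N -> 0 <= central_error n.
Proof.
move=> n0; rewrite subr_ge0 ler_pdivlMr ?ln_central_bin_gt0 // mul1r.
apply: le_trans (ln_central_bin_le n) _.
by rewrite ler_wpM2r ?ler_nat // mulr_ge0 // ltW // ln2_gt0.
Qed.

(** Any bound in o(n) would do; this one is ln x <= x at an upper bound of the
    square root. *)
Lemma ln_nat_le_sqrt n : ln ((2 * n.+1).+1%:R) <= 4 * Num.sqrt (n.+1%:R) :> R.
Proof.
set s := Num.sqrt _.
have s0 : 0 < s by rewrite sqrtr_gt0 ltr0n.
have le : (2 * n.+1).+1%:R <= (2 * s) ^+ 2 :> R.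
  rewrite exprMn sqr_sqrtr ?ler0n // -natrX -natrM ler_nat; lia.
apply: (@le_trans _ _ (ln ((2 * s) ^+ 2))).
  by rewrite ler_ln ?posrE ?ltr0n ?exprn_gt0 ?mulr_gt0.
rewrite lnXn ?mulr_gt0 //.
have : ln (2 * s) < 2 * s by apply: ln_sublinear; rewrite mulr_gt0.
lra.
Qed.

(** Write N for the index [n.+1], L = ln 'C(2N, N), l = ln 2 and s = sqrt N. The
    error is (2 l (N + 1) - L) / L, where the numerator is at most
    2 l + ln (2N + 1) <= 2 l + 4 s <= 6 s, and L >= l N = l s^2. *)
Lemma central_error_le n :
  central_error n.+1 <= 6 / (ln 2 * Num.sqrt n.+1%:R).
Proof.
have l2 := ln2_gt0; have L0 := ln_central_bin_gt0 (ltn0Sn n).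
have l21 : ln 2 <= 1 :> R.
  by apply: (@le_trans _ _ (ln (1 + 1))); rewrite ?le_ln1Dx //; lra.
have ge := ln_central_bin_ge n.+1; have ge2 := ln_central_bin_ge2 n.+1.
have lnle := ln_nat_le_sqrt n; have s2 := sqr_sqrtr (ler0n R n.+1).
have s1 : 1 <= Num.sqrt n.+1%:R :> R.
  by rewrite -[leLHS]sqrtr1 ler_wsqrtr ?ler1n.
rewrite /central_error -(natr1 n.+1).
move: L0 ge ge2 lnle s2 s1; set L := ln 'C(_, _)%:R; set s := Num.sqrt _.
move=> L0 ge ge2 lnle s2 s1; rewrite -s2 in ge ge2 *.
have s0 : 0 < s by apply: lt_le_trans s1.
rewrite lerBlDr ler_pdivrMr // [leRHS]mulrDl [X in _ <= _ + X]mul1r.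
apply: (@le_trans _ _ (6 * s + L)).
  by rewrite mulrDl mul1r; lra.
rewrite lerD2r.
have -> : 6 * s = 6 / (ln 2 * s) * (s ^+ 2 * ln 2) by field; rewrite !gt_eqF.
by rewrite ler_wpM2l // ltW // divr_gt0 // mulr_gt0.
Qed.

Lemma central_error_cvg0 : central_error n @[n --> \oo] --> (0 : R).
Proof.
have l2 := ln2_gt0.
apply/cvgrPdist_le => e e0.
pose N := (6 / (e * ln 2)) ^+ 2.
near=> n; rewrite sub0r normrN.
have : (0 < n)%N by near: n; exact: nbhs_infty_gt.
have : N <= n%:R by near: n; exact: nbhs_infty_ger.
case: (n) => // k leN _.
rewrite ger0_norm ?central_error_ge0 //.
apply: le_trans (central_error_le k) _.
have s0 : 0 < Num.sqrt k.+1%:R :> R by rewrite sqrtr_gt0 ltr0n.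
have N0 : 0 <= 6 / (e * ln 2) by rewrite divr_ge0 // mulr_ge0 // ltW.
have : 6 / (e * ln 2) <= Num.sqrt k.+1%:R.
  by rewrite -[leLHS]ger0_norm // -sqrtr_sqr ler_wsqrtr.
by rewrite ler_pdivrMr ?ler_pdivrMr ?mulr_gt0 // mulrCA mulrA (mulrAC e) mulrA.
Unshelve. all: by end_near. Qed.
End Asymptotics.

(** * Subspaces of half the dimension *)

Lemma half_space_estimates (R : realType) (F : fieldType) (gT : groupType)
    (V : vectType F) (rho : representation gT V) (U : {vspace V}) (n : nat) :
  (0 < n)%N -> \dim (fullv : {vspace V}) = 'C(2 * n, n) ->
  (2 * \dim U = 'C(2 * n, n))%N -> diam_plus rho U = n.+1 ->
  let dimV : R := (\dim (fullv : {vspace V}))%:R in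
  [/\ (\dim U)%:R = dimV / 2,
      (diam_plus rho U)%:R = ln dimV / (2 * ln 2) * (1 + central_error R n),
      covering_complexity rho R >= covering_ratio rho R U &
      covering_ratio rho R U >= ln dimV / (4 * ln 2)].
Proof.
move=> n0 dimVE dimU diamU dimV; have l2 := ln2_gt0 R.
have L0 := ln_central_bin_gt0 R n0.
have dimV2 : dimV = (\dim U)%:R * 2 by rewrite /dimV dimVE -dimU mulnC natrM.
have U0 : (\dim U)%:R != 0 :> R.
  by rewrite pnatr_eq0 -lt0n -(@ltn_pmul2l 2) // muln0 dimU bin_gt0 leq_pmull.
split.
- by rewrite dimV2 mulfK ?pnatr_eq0.
- rewrite diamU /dimV dimVE /central_error; field.
  by rewrite !gt_eqF.
- by apply: covering_ratio_le_complexity; rewrite -dimv_eq0 -(pnatr_eq0 R).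
rewrite /covering_ratio -/dimV dimV2 (mulrC _ 2) mulfK // diamU.
rewrite (_ : Num.ceil (2 : R) = 2) -?dimV2; last by rewrite (intrKceil 2).
rewrite mulrC -dimV2 /dimV dimVE ler_pdivrMr ?mulr_gt0 //.
have := ln_central_bin_le R n; rewrite -natr1.
have : 0 <= (n%:R : R) by [].
nra.
Qed.

Lemma sym_half_space (F : fieldType) (k : nat) :
  exists U : {vspace dhomog k.+1 F k}, (0 < k)%N ->
    (2 * \dim U = 'C(2 * k, k))%N /\ diam_plus (sym_rep F k k) U = k.+1.
Proof.
case: k => [|k]; first by exists 0%VS.
exists (sym_half F k.+1 k) => _; split.
  by rewrite dim_sym_half half_central_bin.
apply: diam_plusE; [exact: sym_half_covered | exact: sym_half_not_covered].
Qed.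

Lemma ext_half_space (F : numFieldType) (m : nat) :
  exists U : {vspace subvs_of (alt_tensors F (2 * m) m)}, (0 < m)%N ->
    (2 * \dim U = 'C(2 * m, m))%N /\ diam_plus (ext_rep F (2 * m) m) U = m.+1.
Proof.
case: (posnP m) => [->|m0]; first by exists 0%VS.
have x0 : 'I_(2 * m) by exists 0%N; rewrite muln_gt0.
exists (ext_half F m x0) => _; split; first exact: dim_ext_half.
have le2m : (m.+1 <= 2 * m)%N by lia.
apply: diam_plusE => [|r rm].
  apply: (@ext_half_covered _ _ _ _ _ (widen_ord le2m)); last by lia.
  by move=> i j /(congr1 val)/= /val_inj.
apply: ext_half_not_covered; lia.
Qed.

Theorem corollary5p10 (R : realType) :
  (exists (U : forall k : nat, {vspace dhomog k.+1 R[i] k}) (eps : nat -> R),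
    eps k @[k --> \oo] --> (0 : R) /\
    forall k : nat, (1 <= k)%N ->
      let rho := sym_rep R[i] k k in
      let dimV : R :=
        (\dim (fullv : {vspace dhomog k.+1 R[i] k}))%:R in
      [/\ (\dim (U k))%:R = dimV / 2,
          (diam_plus rho (U k))%:R = ln dimV / (2 * ln 2) * (1 + eps k),
          covering_complexity rho R >= covering_ratio rho R (U k) &
          covering_ratio rho R (U k) >= ln dimV / (4 * ln 2)])
  /\
  (exists (U : forall m : nat, {vspace subvs_of (alt_tensors R[i] (2 * m) m)})
     (eps : nat -> R),
    eps m @[m --> \oo] --> (0 : R) /\
    forall m : nat, (1 <= m)%N ->
      let rho := ext_rep R[i] (2 * m) m in
      let dimV : R :=
        (\dim (fullv : {vspace subvs_of (alt_tensors R[i] (2 * m) m)}))%:R in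
      [/\ (\dim (U m))%:R = dimV / 2,
          (diam_plus rho (U m))%:R = ln dimV / (2 * ln 2) * (1 + eps m),
          covering_complexity rho R >= covering_ratio rho R (U m) &
          covering_ratio rho R (U m) >= ln dimV / (4 * ln 2)]).
Proof.
split.
  exists (fun k => projT1 (cid (sym_half_space R[i] k))), (central_error R).
  split=> [|k k0]; first exact: central_error_cvg0.
  have [dimU diamU] := projT2 (cid (sym_half_space R[i] k)) k0.
  have dimV : \dim (fullv : {vspace dhomog k.+1 R[i] k}) = 'C(2 * k, k).
    by rewrite dim_sym addnn mul2n.
  exact: half_space_estimates k0 dimV dimU diamU.
exists (fun m => projT1 (cid (ext_half_space R[i] m))), (central_error R).
split=> [|m m0]; first exact: central_error_cvg0.
have [dimU diamU] := projT2 (cid (ext_half_space R[i] m)) m0.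
have x0 : 'I_(2 * m) by exists 0%N; rewrite muln_gt0.
exact: half_space_estimates m0 (dim_ext R[i] m x0) dimU diamU.
Qed.
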